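(* The numerical index of each (non-zero) commutative JB$^*$-triple $E$ is one, that is, $n(E)=1$.
   Context: A JB$^*$-triple is a complex Banach space $E$ with a continuous triple product $\{\cdot,\cdot,\cdot\}:E^3\to E$, linear and symmetric in the outer variables and conjugate-linear in the middle one, such that, with $L(a,b)x=\{a,b,x\}$: (1) $L(a,b)L(x,y)-L(x,y)L(a,b)=L(L(a,b)x,y)-L(x,L(b,a)y)$; (2) $L(a,a)$ is a hermitian operator with non-negative spectrum; (3) $\|\{a,a,a\}\|=\|a\|^3$. $E$ is commutative if $L(a,b)L(x,y)=L(x,y)L(a,b)$ for all $a,b,x,y\in E$. For a Banach space $X\neq\{0\}$ with unit sphere $S_X$ and $T\in B(X)$ (bounded linear operators), $V(T)=\{\phi(Tx): x\in S_X,\ \phi\in S_{X^*},\ \phi(x)=1\}$, $v(T)=\sup\{|\lambda|:\lambda\in V(T)\}$ (numerical radius), and the numerical index is $n(X)=\max\{k\ge 0: k\|T\|\le v(T)\ \forall T\in B(X)\}=\inf\{v(T): T\in B(X),\|T\|=1\}$. *)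

(* Defs.v *)
From mathcomp Require Import all_boot all_order all_algebra.
From mathcomp Require Import all_classical all_reals all_analysis.
From mathcomp Require Import complex.

Set Implicit Arguments.
Unset Strict Implicit.
Unset Printing Implicit Defensive.

Import Order.TTheory GRing.Theory Num.Theory.
Import numFieldNormedType.Exports.

Local Open Scope classical_set_scope.
Local Open Scope ring_scope.

Section BoundedOperators.
Context {R : realType}.

(* The norm of a complex normed space takes its values in R[i], and sup/inf
   are available in R only: this is the norm as a real number. *)
Definition rnorm (X : normedModType R[i]) (x : X) : R := complex.Re `|x|.

Definition bounded_op (X Y : normedModType R[i]) (T : X -> Y) : Prop :=
  linear T /\ continuous T.

Definition opnorm (X Y : normedModType R[i]) (T : X -> Y) : R :=
  sup [set rnorm (T x) | x in [set x : X | `|x| <= 1]].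

Definition num_range (X : normedModType R[i]) (T : X -> X) : set R[i] :=
  [set l | exists (x : X) (phi : X -> R[i]^o),
    [/\ `|x| = 1, bounded_op phi, opnorm phi = 1, phi x = 1 & l = phi (T x)]].

Definition num_radius (X : normedModType R[i]) (T : X -> X) : R :=
  sup [set complex.Re `|l| | l in num_range T].

(* Meaningful for X != {0}, as otherwise no operator has norm 1. *)
Definition num_index (X : normedModType R[i]) : R :=
  inf [set num_radius T | T in [set T : X -> X | bounded_op T /\ opnorm T = 1]].

Definition spectrum (X : normedModType R[i]) (T : X -> X) : set R[i] :=
  [set l | ~ exists S : X -> X,
    [/\ bounded_op S, forall x, S (l *: x - T x) = x
      & forall x, l *: S x - T (S x) = x]].

Definition hermitian (X : normedModType R[i]) (T : X -> X) : Prop :=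
  bounded_op T /\ num_range T `<=` [set l | l \is Num.real].

End BoundedOperators.

Section JBTriples.
Context {R : realType} {E : completeNormedModType R[i]}.
Implicit Type tp : E -> E -> E -> E.

(* On R[i], 0 <= l means that l is real and nonnegative. *)
Record is_JBstar_triple tp : Prop := {
  triple_continuous : continuous (fun p : E * E * E => tp p.1.1 p.1.2 p.2);
  triple_linear : forall y z, linear (fun x => tp x y z);
  triple_conj_linear : forall x z,
    linear_for (@conjc R \; *:%R) (fun y => tp x y z);
  triple_sym : forall x y z, tp x y z = tp z y x;
  triple_jordan : forall a b x y z,
    tp a b (tp x y z) - tp x y (tp a b z) =
      tp (tp a b x) y z - tp x (tp b a y) z;
  triple_hermitian : forall a, hermitian (tp a a);
  triple_spectrum_ge0 : forall a, spectrum (tp a a) `<=` [set l | 0 <= l];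
  triple_norm : forall a, `|tp a a a| = `|a| ^+ 3
}.

Definition commutative_triple tp : Prop :=
  forall a b x y z, tp a b (tp x y z) = tp x y (tp a b z).

End JBTriples.

(* Main.v *)
Require Import Defs.
From mathcomp Require Import all_boot all_order all_algebra.
From mathcomp Require Import all_classical all_reals all_analysis.
From mathcomp Require Import complex.
From mathcomp Require Import ring lra zify.

(** A commutative JB*-triple is, up to pointwise signs, a triple of continuous
    functions with [{a,b,c} = a b* c], and such spaces have numerical index one
    for the same reason as C(K). Let [T] be an operator of norm one and [x0] an
    element of the unit ball such that [T x0] has norm close to one, attained at
    the point [chi]. Changing [x0] only near [chi], one may give it there any
    unimodular value without leaving the unit ball; as [chi x0] is a convex
    combination of two unimodular numbers, [x0] is nearly a convex combination of
    two such elements ([peak_decomposition]). One of them, say [x], satisfies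
    [|chi (T x)|] close to one while [|chi x| = 1], so that a multiple of [chi] is
    a state at [x] witnessing a large numerical radius ([num_radius_approx]).

    It remains to find enough points, that is, a character of absolute value 1 at
    a given [y] of norm one ([exists_character]). By commutativity and the Jordan
    identity the operators [L(a,b)] pass through the triple product ([tp_opl],
    [tp_opm], [tp_opr]); hence cubing is a morphism for it ([tp_cube]), and the
    identity [|{a,a,a}| = |a|^3] forces the triple product to be contractive
    ([tp_contractive]). Among the seminorms that have these properties and are at
    least 1 at [y], Zorn's lemma gives a minimal one, [p]
    ([exists_minimal_seminorm]). If [p a = 1], the infimum over [n] of
    [p (L(a,a)^n x)], which retains only the points where [|a|] is 1, is such a
    seminorm too; minimality makes [L(a,a)] isometric for [p], and [p]
    multiplicative ([minimal_multiplicative]). The elementary proof of the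
    Gelfand-Mazur theorem ([gelfand_mazur]) then shows that [p] is the absolute
    value of a linear functional, the character sought. *)

Set Implicit Arguments.
Unset Strict Implicit.
Unset Printing Implicit Defensive.

Import Order.TTheory GRing.Theory Num.Theory.
Import numFieldNormedType.Exports.

Local Open Scope classical_set_scope.
Local Open Scope ring_scope.
Local Open Scope complex_scope.

(** * Moduli, norms and elementary estimates *)

Section ComplexModulus.
Context {R : realType}.
Implicit Types z w : R[i].

(** On the normed space [R[i]^o] this is [rnorm], by conversion. *)
Definition cmod z : R := complex.Re `|z|.

Lemma normc_cmod z : `|z| = (cmod z)%:C.
Proof. by rewrite /cmod normc_def. Qed.

Lemma cmod_ge0 z : 0 <= cmod z.
Proof. by rewrite -ler0c -normc_cmod. Qed.

Lemma cmodM z w : cmod (z * w) = cmod z * cmod w.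
Proof. by apply: complexI; rewrite rmorphM /= -!normc_cmod normrM. Qed.

Lemma cmodX z n : cmod (z ^+ n) = cmod z ^+ n.
Proof. by apply: complexI; rewrite rmorphXn /= -!normc_cmod normrX. Qed.

Lemma cmodN z : cmod (- z) = cmod z.
Proof. by rewrite /cmod normrN. Qed.

Lemma cmodD z w : cmod (z + w) <= cmod z + cmod w.
Proof. by rewrite -lecR rmorphD /= -!normc_cmod ler_normD. Qed.

Lemma cmodJ z : cmod (conjc z) = cmod z.
Proof. by rewrite /cmod normcJ. Qed.

Lemma cmod_real (r : R) : 0 <= r -> cmod r%:C = r.
Proof. by move=> r0; apply: complexI; rewrite -normc_cmod ger0_norm // ler0c. Qed.

Lemma cmod0 : cmod 0 = 0.
Proof. exact: cmod_real (lexx 0). Qed.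

Lemma cmod1 : cmod 1 = 1.
Proof. exact: cmod_real ler01. Qed.

Lemma cmod_eq0 z : (cmod z == 0) = (z == 0).
Proof.
rewrite -(normr_eq0 z) normc_cmod; apply/eqP/eqP => [->//|[]//].
Qed.

Lemma mulcJ z : z * conjc z = (cmod z ^+ 2)%:C.
Proof. by rewrite rmorphXn /= -normc_cmod sqr_normc. Qed.

Lemma normRe_le_cmod z : `|complex.Re z| <= cmod z.
Proof. by rewrite -lecR -normc_cmod normc_ge_Re. Qed.

Lemma cmodi : cmod 'i%C = 1.
Proof. by rewrite /cmod normc_def /= expr0n expr1n add0r sqrtr1. Qed.

Lemma normIm_le_cmod z : `|complex.Im z| <= cmod z.
Proof.
by rewrite -[cmod z]mulr1 -cmodi -cmodM -normrN -ReiNIm normRe_le_cmod.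
Qed.

Lemma cmod_le_ReIm z : cmod z <= `|complex.Re z| + `|complex.Im z|.
Proof.
rewrite {1}[z]complexE; apply: le_trans (cmodD _ _) _.
have cmodr (r : R) : cmod r%:C = `|r|.
  by rewrite /cmod normc_def /= expr0n addr0 sqrtr_sqr.
by rewrite cmodM !cmodr cmodi mul1r.
Qed.

Lemma exists_real_lt z : 0 < z -> exists2 r : R, 0 < r & r%:C < z.
Proof.
move=> z0; exists (complex.Re z / 2); move: z0; rewrite !ltcE /= => /andP[/eqP e h].
  lra.
by rewrite e eqxx /=; lra.
Qed.

Lemma unimodular_polar z : exists2 u, cmod u = 1 & z = (cmod z)%:C * u.
Proof.
have [->|z0] := eqVneq z 0; first by exists 1; rewrite ?cmod1 // cmod0 mul0r.
have cz0 : (cmod z)%:C != 0 by rewrite -normc_cmod normr_eq0.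
exists (z / (cmod z)%:C); last by rewrite mulrCA divff ?mulr1.
have := cmodM (z / (cmod z)%:C) (cmod z)%:C.
rewrite divfK // cmod_real ?cmod_ge0 // => h.
have c0 : cmod z != 0 by rewrite cmod_eq0.
by apply: (mulIf c0); rewrite -h mul1r.
Qed.

End ComplexModulus.

Section RealNorm.
Context {R : realType} {X : normedModType R[i]}.
Implicit Types x y : X.

Lemma norm_rnorm x : `|x| = (rnorm x)%:C.
Proof.
rewrite /rnorm; have := normr_ge0 x; case: (`|x|) => a b.
by rewrite lecE /= => /andP[/eqP -> _].
Qed.

Lemma rnorm_ge0 x : 0 <= rnorm x.
Proof. by rewrite -ler0c -norm_rnorm. Qed.

Lemma rnormD x y : rnorm (x + y) <= rnorm x + rnorm y.
Proof. by rewrite -lecR rmorphD /= -!norm_rnorm ler_normD. Qed.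

Lemma rnormZ l x : rnorm (l *: x) = cmod l * rnorm x.
Proof.
by apply: complexI; rewrite rmorphM /= -norm_rnorm normrZ norm_rnorm normc_cmod.
Qed.

Lemma rnorm_eq0 x : (rnorm x == 0) = (x == 0).
Proof. by rewrite -(normr_eq0 x) norm_rnorm; apply/eqP/eqP => [->//|[]//]. Qed.

Lemma rnorm_gt0 x : x != 0 -> 0 < rnorm x.
Proof. by move=> x0; rewrite lt_neqAle eq_sym rnorm_eq0 x0 rnorm_ge0. Qed.

Lemma rnorm0 : rnorm (0 : X) = 0.
Proof. by apply/eqP; rewrite rnorm_eq0. Qed.

Lemma norm_le1 x : (`|x| <= 1) = (rnorm x <= 1).
Proof. by rewrite norm_rnorm -lecR. Qed.

Lemma norm_eq1 x : (`|x| = 1) <-> (rnorm x = 1).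
Proof. by rewrite norm_rnorm; split=> [[]//|->]. Qed.

End RealNorm.

Lemma addself_eq0 (V : zmodType) (x : V) : x + x = x -> x = 0.
Proof. by move=> h; apply: (addrI x); rewrite addr0. Qed.

Section Seminorms.
Context {R : realType} {V : lmodType R[i]}.

Definition seminorm (p : V -> R) : Prop :=
  (forall x y, p (x + y) <= p x + p y) /\
  (forall (l : R[i]) x, p (l *: x) = cmod l * p x).

Variable p : V -> R.
Hypothesis hp : seminorm p.

Lemma seminormD x y : p (x + y) <= p x + p y. Proof. exact: hp.1. Qed.

Lemma seminormZ (l : R[i]) x : p (l *: x) = cmod l * p x. Proof. exact: hp.2. Qed.

Lemma seminorm0 : p 0 = 0.
Proof. by rewrite -(scale0r 0) seminormZ cmod0 mul0r. Qed.

Lemma seminormN x : p (- x) = p x.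
Proof. by rewrite -scaleN1r seminormZ cmodN cmod1 mul1r. Qed.

Lemma seminormB x y : p (x - y) <= p x + p y.
Proof. by rewrite -(seminormN y) seminormD. Qed.

Lemma seminorm_ge0 x : 0 <= p x.
Proof. by have := seminormB x x; rewrite subrr seminorm0; lra. Qed.

Lemma seminormC x y : p (x - y) = p (y - x).
Proof. by rewrite -seminormN opprB. Qed.

Lemma seminorm_congr x y : p (x - y) = 0 -> p x = p y.
Proof.
move=> h; have := seminormD (x - y) y; have := seminormD (y - x) x.
by rewrite !subrK (seminormC y x) h; lra.
Qed.

End Seminorms.

Lemma rnorm_seminorm (R : realType) (X : normedModType R[i]) :
  seminorm (@rnorm R X).
Proof. by split=> [x y|l x]; [apply: rnormD|apply: rnormZ]. Qed.

Section RealEstimates.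
Context {R : realType}.
Implicit Types x y a r : R.

Lemma bernoulli r n : 0 <= r -> 1 + n%:R * r <= (1 + r) ^+ n.
Proof.
move=> r0; elim: n => [|n IHn]; first by rewrite mul0r addr0 expr0.
rewrite exprS -natr1; have n0 : 0 <= n%:R :> R by [].
have := ler_wpM2l (_ : 0 <= 1 + r) IHn; rewrite -subr_ge0 => /(_ _).
by nra.
Qed.

Lemma pow1D_le r n : 0 <= r <= 1 -> (1 + r) ^+ n <= 1 + (2 ^+ n - 1) * r.
Proof.
move=> /andP[r0 r1]; elim: n => [|n IHn]; first by rewrite !expr0 subrr mul0r addr0.
have P1 : 1 <= 2 ^+ n :> R by rewrite exprn_ege1 //; lra.
rewrite !exprS; have : (1 + r) * (1 + r) ^+ n <= (1 + r) * (1 + (2 ^+ n - 1) * r).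
  by rewrite ler_wpM2l // addr_ge0.
have : 0 <= (2 ^+ n - 1) * (r * (1 - r)) by rewrite !mulr_ge0 ?subr_ge0.
lra.
Qed.

Lemma expr_small r a : 0 <= r < 1 -> 0 < a -> exists n, r ^+ n < a.
Proof.
move=> /andP[]; rewrite le_eqVlt => /predU1P[<- _ a0|r0 r1 a0].
  by exists 1%N; rewrite expr1.
pose h := r^-1 - 1.
have h0 : 0 < h by rewrite subr_gt0 invf_gt1.
pose n := Num.bound ((a * h)^-1).
exists n; have an : (a * h)^-1 < n%:R.
  by apply: archi_boundP; rewrite invr_ge0 mulr_ge0 ?ltW.
have h1 : 1 + h = r^-1 by rewrite addrC subrK.
have := @bernoulli h n (ltW h0); rewrite h1 exprVn => hn.
have rn0 : 0 < r ^+ n by rewrite exprn_gt0.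
rewrite -(ltf_pV2 (x := a) (y := r ^+ n)) ?posrE //.
apply: lt_le_trans hn; move: an; rewrite invfM ltr_pdivrMr //; lra.
Qed.

(** A multiplicative constant disappears when one extracts n-th roots and
    lets n go to infinity. *)
Lemma le_of_pow_le (d : nat) (C x y : R) : (1 < d)%N -> 0 <= x -> 0 <= y ->
  (forall n, x ^+ (d ^ n) <= C * y ^+ (d ^ n)) -> x <= y.
Proof.
move=> d1 x0 y0 h; rewrite leNgt; apply/negP => yx.
have {}x0 : 0 < x by apply: le_lt_trans yx.
have C0 : 0 < C.
  have := h 0%N; rewrite !expr1 => h0; rewrite ltNge; apply/negP => C0.
  have : C * y <= 0 by rewrite mulr_le0_ge0.
  lra.
have /(@expr_small (y / x)) : 0 <= y / x < 1.
  by rewrite divr_ge0 ?(ltW x0) //= ltr_pdivrMr // mul1r.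
have iC : 0 < C^-1 by rewrite invr_gt0.
move=> /(_ _ iC) [n hn].
have yx1 : y / x <= 1 by rewrite ler_pdivrMr // mul1r ltW.
have : (y / x) ^+ (d ^ n) < C^-1.
  apply: le_lt_trans hn; apply: ler_wiXn2l => //; first by rewrite divr_ge0 // ltW.
  by rewrite ltnW // ltn_expl.
rewrite exprMn exprVn ltr_pdivrMr ?exprn_gt0 // ltr_pdivlMl // ltNge.
by rewrite h.
Qed.

End RealEstimates.

(** * A Gelfand-Mazur theorem for multiplicative seminorms *)

Section GelfandMazur.
Context {R : realType} {V : lmodType R[i]}.
Variables (p : V -> R) (mul : V -> V -> V) (u : V).
Hypothesis hp : seminorm p.
Hypothesis mulC : forall a b, mul a b = mul b a.
Hypothesis mul_linear : forall b, linear (mul^~ b).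
Hypothesis pM : forall a b, p (mul a b) = p a * p b.
Hypothesis pu : p u = 1.

Let p_ge0 x : 0 <= p x := seminorm_ge0 hp x.

Let mulDl a b c : mul (a + b) c = mul a c + mul b c.
Proof. by have := mul_linear c 1 a b; rewrite !scale1r. Qed.

Let mulZl l a c : mul (l *: a) c = l *: mul a c.
Proof.
have mul0 : mul 0 c = 0 by apply: addself_eq0; rewrite -mulDl addr0.
by have := mul_linear c l a 0; rewrite mul0 !addr0.
Qed.

Let mul_diff_squares (l : R[i]) a b :
  mul (a - l *: b) (a + l *: b) = mul a a - l ^+ 2 *: mul b b.
Proof.
rewrite -scaleNr mulDl mulZl !(mulC _ (a + _)) !mulDl !mulZl !scalerDr !scalerA.
by rewrite (mulC b a) !scaleNr mulNr -expr2 scaleNr addrA addrK.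
Qed.

(** The power [a ^ (2 ^ k)], which iterated squaring makes unambiguous for a
    product that may fail to be associative. *)
Definition pow2 (a : V) k := iter k (fun b => mul b b) a.

Lemma p_pow2 a k : p (pow2 a k) = p a ^+ (2 ^ k).
Proof.
elim: k => [|k IHk]; first by rewrite expr1.
by rewrite /= pM IHk -exprD addnn -mul2n -expnS.
Qed.

Section LowerBound.
Variables (b : V) (m : R).
Hypothesis m0 : 0 <= m.
Hypothesis mb : forall l : R[i], m <= p (b - l *: u).

(** Over the complex numbers [X^2 - l Y^2] splits into linear factors, and the
    lower bound [m] holds for every factor. *)
Lemma pow2_dist_ge (l : R[i]) k : m ^+ (2 ^ k) <= p (pow2 b k - l *: pow2 u k).
Proof.
elim: k l => [|k IHk] l; first by rewrite expr1 mb.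
rewrite -(sqr_sqrtc l) /= -mul_diff_squares pM expnS mul2n -addnn exprD.
by rewrite ler_pM ?exprn_ge0 // -[in leRHS](opprK (sqrtc l)) scaleNr.
Qed.

(** Factoring [X^(2^k) - (l Y)^(2^k)], one keeps the factor [X - l Y] and
    estimates each of the others, [X^(2^j) + (l Y)^(2^j)], from below. *)
Lemma pow2_dist_factor (l : R[i]) k :
  p (b - l *: u) * m ^+ (2 ^ k).-1
    <= p (pow2 b k - l ^+ (2 ^ k) *: pow2 u k).
Proof.
elim: k => [|k IHk]; first by rewrite expr1 expr0 mulr1.
rewrite /= expnS mul2n -muln2 exprM -mul_diff_squares pM.
have -> : (2 ^ k * 2).-1 = ((2 ^ k).-1 + 2 ^ k)%N.
  by have := expn_gt0 2 k; lia.
rewrite exprD mulrA ler_pM ?mulr_ge0 ?exprn_ge0 //.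
by rewrite -[in leRHS](opprK (l ^+ _)) scaleNr pow2_dist_ge.
Qed.

(** If [p b] is close to the minimum [m] and [cmod l < m], then letting [k] grow
    (before choosing [b]) shows that [p (b - l *: u)] is close to [m] as well. *)
Lemma dist_translate_le (l : R[i]) k :
  p (b - l *: u) * m ^+ (2 ^ k).-1 <= p b ^+ (2 ^ k) + cmod l ^+ (2 ^ k).
Proof.
apply: le_trans (pow2_dist_factor l k) _; apply: le_trans (seminormB hp _ _) _.
by rewrite (seminormZ hp) !p_pow2 pu expr1n mulr1 cmodX.
Qed.

End LowerBound.

Section Inf.
Variable a : V.

Let f (l : R[i]) := p (a - l *: u).
Let m := inf (range f).

Let f_has_inf : has_inf (range f).
Proof.
split; first by exists (f 0), 0.
by exists 0 => _ [l _ <-]; apply: p_ge0.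
Qed.

Let m_le l : m <= f l.
Proof. by apply: ge_inf; [case: f_has_inf|exists l]. Qed.

(* The triangle inequality for the multiple l - l' of u. *)
Let f_lip l l' : cmod (l - l') <= f l + f l'.
Proof.
have -> : cmod (l - l') = p ((l - l') *: u) by rewrite (seminormZ hp) pu mulr1.
rewrite scalerBl -(seminormN hp) opprB (_ : _ - _ = (a - l *: u) - (a - l' *: u)).
  exact: seminormB.
by rewrite opprB [RHS]addrC addrA subrK.
Qed.

(* An almost minimizer l for which l + N (m / 2) is also an almost minimizer:
   the distance to the line stays almost minimal along a translation. *)
Let m_propagate N : 0 < m -> forall e, 0 < e ->
  exists2 l, f l < m * (1 + e) & f (l + (m / 2 *+ N)%:C) < m * (1 + e).
Proof.
move=> m0; elim: N => [|N IHN] e e0.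
  have me0 : 0 < m * e by rewrite mulr_gt0.
  have [_ [l _ <-]] := inf_adherent me0 f_has_inf.
  by rewrite -/m => h; exists l; rewrite ?mulr0n ?addr0 mulrDr mulr1.
have half01 : 0 <= (2^-1 : R) < 1 by apply/andP; split; lra.
have e20 : 0 < e / 2 by lra.
have [k hk] := expr_small half01 e20.
set n := (2 ^ k)%N.
have kn : (k <= n)%N by rewrite ltnW // ltn_expl.
have hn : 2^-1 ^+ n < e / 2 :> R.
  by apply: le_lt_trans hk; apply: ler_wiXn2l => //; lra.
(* [d] is small enough for the n-th power of 1 + d to stay below 1 + e / 2. *)
have [d [d0 de dn]] : exists d : R, [/\ 0 < d, d <= e & (1 + d) ^+ n <= 1 + e / 2].
  have P0 : 0 < 2 ^+ n :> R by rewrite exprn_gt0.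
  have P1 : 1 <= 2 ^+ n :> R by rewrite exprn_ege1 //; lra.
  have [c [c0 c1 ce]] : exists c : R, [/\ 0 < c, c <= 1 & c <= e].
    by exists (Num.min 1 e); rewrite lt_min ltr01 e0 !ge_min !lexx orbT.
  have dP : c / 2 / 2 ^+ n * 2 ^+ n = c / 2 by rewrite divfK // gt_eqF.
  have d0 : 0 < c / 2 / 2 ^+ n by rewrite !divr_gt0.
  exists (c / 2 / 2 ^+ n); split=> //; first by nra.
  by apply: le_trans (pow1D_le _ _) _; [nra|lra].
have [l hl hN] := IHN d d0.
exists l; first by apply: lt_le_trans hl _; rewrite ler_pM2l // lerD2l.
have mb l' : m <= p (a - (l + (m / 2 *+ N)%:C) *: u - l' *: u).
  by rewrite -addrA -opprD -scalerDl m_le.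
have := dist_translate_le (ltW m0) mb (m / 2)%:C k.
rewrite -addrA -opprD -scalerDl -addrA -rmorphD -mulrSr -/(f _) -/(f _) -/n.
rewrite cmod_real ?divr_ge0 ?(ltW m0) // => h.
have n0 : (0 < n)%N by rewrite expn_gt0.
have mn0 : 0 < m ^+ n.-1 by rewrite exprn_gt0.
rewrite -(ltr_pM2r mn0); apply: le_lt_trans h _.
have -> : m * (1 + e) * m ^+ n.-1 = m ^+ n * (1 + e).
  by rewrite mulrAC -exprS prednK.
have : f (l + (m / 2 *+ N)%:C) ^+ n <= (m * (1 + d)) ^+ n.
  by rewrite lerXn2r ?nnegrE ?p_ge0 ?mulr_ge0 ?ltW //; lra.
rewrite !exprMn exprVn; have mm0 : 0 < m ^+ n by rewrite exprn_gt0.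
move=> h1.
have : m ^+ n * (1 + d) ^+ n <= m ^+ n * (1 + e / 2) by rewrite ler_pM2l.
have : m ^+ n * 2^-1 ^+ n < m ^+ n * (e / 2) by rewrite ltr_pM2l.
rewrite exprVn; lra.
Qed.

(* Eight steps of length m / 2 cover a distance 4 m, but two points where f is
   below 2 m are at distance less than 4 m. *)
Let m_eq0 : m = 0.
Proof.
have : 0 <= m by apply: lb_le_inf; [case: f_has_inf|move=> _ [l _ <-]; apply: p_ge0].
rewrite le_eqVlt => /predU1P[//|m0].
have [l h0 h8] := m_propagate 8 m0 ltr01.
have m4 : m / 2 *+ 8 = m * 4 by rewrite -mulr_natr; lra.
have := f_lip (l + (m / 2 *+ 8)%:C) l; move: h8; rewrite m4 => h8.
rewrite addrAC subrr add0r cmod_real; last lra.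
lra.
Qed.

(** The infimum of [p (a - l *: u)] over [l] vanishes, and almost minimizers
    form a Cauchy family. The limit is found coordinate by coordinate: for a
    1-Lipschitz [g], the supremum of [g l - p (a - l *: u)] lies within
    [p (a - l *: u)] of every [g l]. *)
Lemma gelfand_mazur : exists l : R[i], p (a - l *: u) = 0.
Proof.
have coord (g : R[i] -> R) : (forall l l', `|g l - g l'| <= cmod (l - l')) ->
    exists s, forall l, `|s - g l| <= f l.
  move=> hg; have le l l' : g l - f l <= g l' + f l'.
    by have := hg l l'; have := f_lip l l'; have := ler_norm (g l - g l'); lra.
  exists (sup [set g l - f l | l in setT]) => l'.
  rewrite ler_norml; apply/andP; split.
    have : g l' - f l' <= sup [set g l - f l | l in setT].
      apply: ub_le_sup; last by exists l'.
      by exists (g l' + f l') => _ [l _ <-].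
    lra.
  have : sup [set g l - f l | l in setT] <= g l' + f l'.
    by apply: ge_sup => [|_ [l _ <-]]; [exists (g l' - f l'), l'|].
  lra.
have [s hs] : exists s, forall l, `|s - complex.Re l| <= f l.
  by apply: coord => -[a1 a2] [b1 b2];
    have := normRe_le_cmod (Complex a1 a2 - Complex b1 b2).
have [t ht] : exists s, forall l, `|s - complex.Im l| <= f l.
  by apply: coord => -[a1 a2] [b1 b2];
    have := normIm_le_cmod (Complex a1 a2 - Complex b1 b2).
exists (s +i* t); apply/eqP; rewrite eq_le p_ge0 andbT.
apply/ler_addgt0Pr => e e0.
rewrite add0r.
have e30 : 0 < e / 3 by lra.
have [_ [l _ <-]] := inf_adherent e30 f_has_inf; rewrite -/m m_eq0 add0r => fl.
have := cmod_le_ReIm (s +i* t - l).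
have := hs l; have := ht l; case: l fl => x y /= fl hx hy hc.
have : f (s +i* t) <= f (x +i* y) + cmod (s +i* t - x +i* y).
  have -> : cmod (s +i* t - x +i* y) = p ((s +i* t - x +i* y) *: u).
    by rewrite (seminormZ hp) pu mulr1.
  rewrite -(seminormN hp (_ *: u)) /f.
  rewrite (_ : a - (s +i* t) *: u =
    (a - (x +i* y) *: u) - (s +i* t - x +i* y) *: u).
    exact: seminormD.
  by rewrite -addrA -opprD -scalerDl (addrC (x +i* y)) subrK.
rewrite -/(f _); lra.
Qed.

End Inf.
End GelfandMazur.

(** * The triple product of a commutative triple *)

Section CommutativeTriple.
Context {R : realType} {E : completeNormedModType R[i]}.
Variable tp : E -> E -> E -> E.
Hypothesis hE : is_JBstar_triple tp.
Hypothesis hcomm : commutative_triple tp.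

Lemma tpDl a b y z : tp (a + b) y z = tp a y z + tp b y z.
Proof. by have := triple_linear hE y z 1 a b; rewrite !scale1r. Qed.

Lemma tp0l y z : tp 0 y z = 0.
Proof. by apply: addself_eq0; rewrite -tpDl addr0. Qed.

Lemma tpZl l a y z : tp (l *: a) y z = l *: tp a y z.
Proof. by have := triple_linear hE y z l a 0; rewrite tp0l !addr0. Qed.

Lemma tpC a b c : tp a b c = tp c b a.
Proof. exact: triple_sym hE a b c. Qed.

Lemma tpDr a y b c : tp a y (b + c) = tp a y b + tp a y c.
Proof. by rewrite tpC tpDl !(tpC a). Qed.

Lemma tpZr l a y b : tp a y (l *: b) = l *: tp a y b.
Proof. by rewrite tpC tpZl (tpC a). Qed.

Lemma tpDm a b c z : tp a (b + c) z = tp a b z + tp a c z.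
Proof.
have := triple_conj_linear hE a z 1 b c; rewrite scale1r.
rewrite (_ : (conjc \; *:%R) 1 = id) //; apply/funext => x /=.
by rewrite -[RHS]scale1r; congr (_ *: _); exact: conjc1.
Qed.

Lemma tp0m a z : tp a 0 z = 0.
Proof. by apply: addself_eq0; rewrite -tpDm addr0. Qed.

Lemma tpZm l a b z : tp a (l *: b) z = conjc l *: tp a b z.
Proof. by have := triple_conj_linear hE a z l b 0; rewrite /= tp0m !addr0. Qed.

(** With [hcomm], the Jordan identity says that [L(a,b)] passes through each of
    the three slots of the triple product, becoming [L(b,a)] in the middle one:
    the operators [L(a,b)] behave like multiplications by [a b*]. *)
Lemma tp_opr a b x y z : tp a b (tp x y z) = tp x y (tp a b z).
Proof. exact: hcomm. Qed.

Lemma tp_opl a b x y z : tp a b (tp x y z) = tp (tp a b x) y z.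
Proof. by rewrite (tpC x) tp_opr (tpC z). Qed.

Lemma tp_opm a b x y z : tp a b (tp x y z) = tp x (tp b a y) z.
Proof.
have := triple_jordan hE a b x y z; rewrite hcomm subrr => /esym/eqP.
by rewrite subr_eq0 -(tp_opr a b x) (tp_opl a b x) => /eqP.
Qed.

Lemma tp_swap a b x : tp a a (tp b b x) = tp a b (tp b a x).
Proof. by rewrite tp_opm [RHS]tp_opm (tpC a a b). Qed.

(** Pointwise, this is
    [(a b* c) (a b* c)* (a b* c) = (a a* a) (b b* b)* (c c* c)]. *)
Lemma tp_cube a b c :
  tp (tp a b c) (tp a b c) (tp a b c) = tp (tp a a a) (tp b b b) (tp c c c).
Proof.
rewrite -tp_opl -tp_opm -(tp_opr a b c c c) -(tp_opl a a a) -(tp_opm b b).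
by rewrite tp_swap.
Qed.

Lemma tp_bounded : exists2 C : R, 0 <= C &
  forall a b c, rnorm (tp a b c) <= C * (rnorm a * rnorm b * rnorm c).
Proof.
have := @triple_continuous R E tp hE (0 : E * E * E).
move=> /cvgr_dist_le /(_ 1 ltr01) /nbhs_ballP [d /= d0 hd].
have [r r0 rd] := exists_real_lt d0.
have r1 a b c : rnorm a <= r -> rnorm b <= r -> rnorm c <= r ->
    rnorm (tp a b c) <= 1.
  move=> ha hb hc; rewrite -norm_le1.
  have := hd (a, b, c); rewrite /= tp0l sub0r normrN; apply.
  do 2?split=> /=; rewrite -ball_normE /= sub0r normrN norm_rnorm;
    by apply: le_lt_trans rd; rewrite lecR.
pose C := (r ^+ 3)^-1.
have C0 : 0 <= C by rewrite invr_ge0 exprn_ge0 // ltW.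
exists C => // a b c.
have scale (x : E) : x != 0 -> exists2 l : R, 0 < l &
    rnorm (l%:C *: x) <= r /\ l = r / rnorm x.
  move=> /rnorm_gt0 nx.
  exists (r / rnorm x); first by rewrite divr_gt0.
  split=> //; rewrite rnormZ cmod_real; last by rewrite divr_ge0 ?ltW.
  by rewrite divfK // gt_eqF.
have [->|a0] := eqVneq a 0; first by rewrite tp0l rnorm0 !mul0r mulr0.
have [->|b0] := eqVneq b 0; first by rewrite tp0m rnorm0 mulr0 mul0r mulr0.
have [->|c0] := eqVneq c 0; first by rewrite tpC tp0l rnorm0 !mulr0.
have [la la0 [ha ea]] := scale a a0.
have [lb lb0 [hb eb]] := scale b b0.
have [lc lc0 [hc ec]] := scale c c0.
have := r1 _ _ _ ha hb hc.
rewrite tpZl tpZm tpZr !rnormZ cmodJ.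
rewrite !cmod_real ?(ltW la0) ?(ltW lb0) ?(ltW lc0) // => h.
have e : C * (rnorm a * rnorm b * rnorm c) * (la * (lb * lc)) = 1.
  have := rnorm_gt0 a0; have := rnorm_gt0 b0; have := rnorm_gt0 c0 => pc pb pa.
  rewrite /C ea eb ec; field; do ?split; by rewrite ?gt_eqF // exprn_gt0.
have l0 : 0 < la * (lb * lc) by rewrite !mulr_gt0.
have : rnorm (tp a b c) * (la * (lb * lc)) <= 1.
  by rewrite mulrC -!mulrA.
by rewrite -e ler_pM2r.
Qed.

(** Continuity gives the estimate with some constant [C]. Cubing is compatible
    with the triple product and with the norm, so the same [C] serves for all
    powers [3 ^ n] of both sides, and can then be dropped. *)
Lemma tp_contractive a b c :
  rnorm (tp a b c) <= rnorm a * rnorm b * rnorm c.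
Proof.
have [C C0 hC] := tp_bounded.
have rn0 := @rnorm_ge0 R E.
apply: (@le_of_pow_le _ 3 C) => //; rewrite ?mulr_ge0 //.
have cube x : rnorm (tp x x x) = rnorm x ^+ 3.
  by apply: complexI; rewrite rmorphXn /= -!norm_rnorm; exact: (triple_norm hE).
move=> n; elim: n a b c => [|n IHn] a b c; first by rewrite !expr1.
by have := IHn (tp a a a) (tp b b b) (tp c c c);
  rewrite -tp_cube !cube -!exprMn -!exprM -expnS.
Qed.

End CommutativeTriple.

(** * Minimal seminorms compatible with the triple product *)

Section Localization.
Context {R : realType} {E : completeNormedModType R[i]}.
Variable tp : E -> E -> E -> E.
Hypothesis hE : is_JBstar_triple tp.
Hypothesis hcomm : commutative_triple tp.
Variable y : E.
Implicit Types (p q : E -> R).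

(** For a triple of continuous functions, the examples are the suprema of [|x|]
    over a set of points containing one where [1 <= |y|]; a minimal one is
    concentrated at a point. By [ts_tp_le], [ts_cube] is an equality. *)
Record triple_seminorm p : Prop := {
  ts_seminorm : seminorm p;
  ts_le_norm : forall x, p x <= rnorm x;
  ts_tp_le : forall a b c, p (tp a b c) <= p a * p b * p c;
  ts_cube : forall x, p x ^+ 3 <= p (tp x x x);
  ts_ge1 : 1 <= p y
}.

(** Two uses share the following section: infima of chains, for Zorn's lemma, and
    infima of the decreasing sequences [p \o L(a,a)^n]. In the second one the
    estimates for the triple product relate different members of the family,
    which is why [F_tp] and [F_cube] involve a second seminorm. *)
Section DirectedInf.
Variable F : set (E -> R).
Hypothesis F0 : F !=set0.
Hypothesis F_seminorm : forall q, F q -> seminorm q.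
Hypothesis F_le : forall q, F q -> forall x, q x <= rnorm x.
Hypothesis F_ge1 : forall q, F q -> 1 <= q y.
Hypothesis F_directed : forall q1 q2, F q1 -> F q2 ->
  exists q, [/\ F q, forall x, q x <= q1 x & forall x, q x <= q2 x].
Hypothesis F_tp : forall q, F q ->
  exists2 q', F q' & forall a b c, q' (tp a b c) <= q a * q b * q c.
Hypothesis F_cube : forall q, F q ->
  exists2 q', F q' & forall x, q' x ^+ 3 <= q (tp x x x).

Definition inf_seminorm x : R := inf [set q x | q in F].

Let has_inf_at x : has_inf [set q x | q in F].
Proof.
split; first by have [q Fq] := F0; exists (q x), q.
by exists 0 => _ [q Fq <-]; apply: (seminorm_ge0 (F_seminorm Fq)).
Qed.

Lemma inf_seminorm_le q x : F q -> inf_seminorm x <= q x.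
Proof. by move=> Fq; apply: ge_inf; [case: (has_inf_at x)|exists q]. Qed.

Lemma le_inf_seminorm c x : (forall q, F q -> c <= q x) -> c <= inf_seminorm x.
Proof.
by move=> h; apply: lb_le_inf; [case: (has_inf_at x)|move=> _ [q Fq <-]; apply: h].
Qed.

Let inf_ge0 x : 0 <= inf_seminorm x.
Proof.
by apply: le_inf_seminorm => q Fq; apply: (seminorm_ge0 (F_seminorm Fq)).
Qed.

Let le_mul_inf c k x : 0 <= k -> (forall q, F q -> c <= k * q x) ->
  c <= k * inf_seminorm x.
Proof.
rewrite le_eqVlt => /predU1P[<-|k0] h.
  by have [q Fq] := F0; have := h q Fq; rewrite !mul0r.
rewrite -ler_pdivrMl //; apply: le_inf_seminorm => q Fq.
by rewrite ler_pdivrMl // h.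
Qed.

Lemma inf_triple_seminorm : triple_seminorm inf_seminorm.
Proof.
have q_ge0 q x : F q -> 0 <= q x by move=> Fq; apply: (seminorm_ge0 (F_seminorm Fq)).
split.
- split=> [x z|l x].
    rewrite -lerBlDr; apply: le_inf_seminorm => q1 Fq1.
    rewrite lerBlDl -lerBlDr; apply: le_inf_seminorm => q2 Fq2; rewrite lerBlDr.
    have [q [Fq le1 le2]] := F_directed Fq1 Fq2.
    apply: le_trans (inf_seminorm_le _ Fq) _.
    by apply: le_trans (seminormD (F_seminorm Fq) _ _) _; rewrite addrC lerD.
  apply/eqP; rewrite eq_le; apply/andP; split.
    apply: le_mul_inf => [|q Fq]; first exact: cmod_ge0.
    by rewrite -(seminormZ (F_seminorm Fq)) inf_seminorm_le.
  apply: le_inf_seminorm => q Fq; rewrite (seminormZ (F_seminorm Fq)).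
  by rewrite ler_wpM2l ?cmod_ge0 ?inf_seminorm_le.
- move=> x; have [q Fq] := F0.
  exact: le_trans (inf_seminorm_le x Fq) (F_le Fq x).
- move=> a b c; apply: le_mul_inf => [|q3 Fq3]; first by rewrite mulr_ge0.
  rewrite mulrAC; apply: le_mul_inf => [|q2 Fq2].
    by rewrite mulr_ge0 ?inf_ge0 ?q_ge0.
  rewrite -mulrA mulrC; apply: le_mul_inf => [|q1 Fq1].
    by rewrite mulr_ge0 ?inf_ge0 ?q_ge0.
  have [q12 [F12 le1 le2]] := F_directed Fq1 Fq2.
  have [q [Fq le12 le3]] := F_directed F12 Fq3.
  have [q' Fq' hq'] := F_tp Fq.
  apply: le_trans (inf_seminorm_le _ Fq') _; apply: le_trans (hq' a b c) _.
  rewrite -mulrA [leRHS]mulrC (mulrC (q3 c)) !ler_pM ?mulr_ge0 ?q_ge0 //.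
    exact: le_trans (le12 a) (le1 a).
  exact: le_trans (le12 b) (le2 b).
- move=> x; apply: le_inf_seminorm => q Fq; have [q' Fq' hq'] := F_cube Fq.
  apply: le_trans (hq' x); rewrite lerXn2r ?nnegrE ?inf_ge0 ?q_ge0 //.
  exact: inf_seminorm_le.
- exact: le_inf_seminorm.
Qed.

End DirectedInf.

Lemma norm_triple_seminorm : rnorm y = 1 -> triple_seminorm (@rnorm R E).
Proof.
move=> y1; split=> //; last by rewrite y1.
- exact: rnorm_seminorm.
- by move=> a b c; exact: (tp_contractive hE hcomm).
move=> x; rewrite le_eqVlt; apply/orP; left; apply/eqP/complexI.
by rewrite rmorphXn /= -!norm_rnorm (triple_norm hE).
Qed.

Definition minimal_seminorm p : Prop :=
  triple_seminorm p /\
  forall q, triple_seminorm q -> (forall x, q x <= p x) -> q = p.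

Lemma exists_minimal_seminorm : rnorm y = 1 -> exists p, minimal_seminorm p.
Proof.
move=> y1.
pose T := {p : E -> R | triple_seminorm p}.
pose le (p q : T) := `[< forall x, sval q x <= sval p x >].
have [] := @Zorn T le.
- by move=> t; apply/asboolP => x.
- move=> r s t /asboolP h1 /asboolP h2; apply/asboolP => x.
  exact: le_trans (h2 x) (h1 x).
- move=> [s hs] [t ht] /asboolP /= h1 /asboolP /= h2.
  by apply: eq_exist; apply/funext => x; apply/eqP; rewrite eq_le h1 h2.
- move=> A totA.
  have [[t0 At0]|A0] := pselect (A !=set0); last first.
    exists (exist _ _ (norm_triple_seminorm y1)) => s As.
    by exfalso; apply: A0; exists s.
  pose F := [set sval t | t in A].
  have Fts q : F q -> triple_seminorm q by move=> [t _ <-]; exact: (svalP t).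
  have FT : triple_seminorm (inf_seminorm F).
    apply: inf_triple_seminorm.
    + by exists (sval t0), t0.
    + by move=> q /Fts [].
    + by move=> q /Fts [].
    + by move=> q /Fts [].
    + move=> _ _ [t1 A1 <-] [t2 A2 <-].
      have [/asboolP h|/asboolP h] := totA _ _ A1 A2.
        by exists (sval t2); split=> //; exists t2.
      by exists (sval t1); split=> //; exists t1.
    + by move=> q Fq; exists q => //; case: (Fts q Fq).
    + by move=> q Fq; exists q => //; case: (Fts q Fq).
  exists (exist _ _ FT) => s As; apply/asboolP => x /=.
  apply: inf_seminorm_le; last by exists s.
    by exists (sval t0), t0.
  by move=> q /Fts [].
- move=> [p hp] hmin; exists p; split=> // q hq qp.
  have := hmin (exist _ q hq); rewrite /le /=.
  by move=> /(_ (introT (asboolP _) qp)) [].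
Qed.

Section Minimal.
Variable p : E -> R.
Hypothesis hmin : minimal_seminorm p.

Let hts : triple_seminorm p := hmin.1.
Let hp : seminorm p := ts_seminorm hts.
Let p_ge0 x : 0 <= p x := seminorm_ge0 hp x.

Hypothesis y1 : rnorm y = 1.

Lemma minimal_at_y : p y = 1.
Proof. by apply/eqP; rewrite eq_le (ts_ge1 hts) -y1 (ts_le_norm hts). Qed.

Let L a := tp a a.

Let L_le a x : p a <= 1 -> p (L a x) <= p x.
Proof.
move=> a1; apply: le_trans (ts_tp_le hts _ _ _) _.
by rewrite -[leRHS]mul1r ler_wpM2r // mulr_ile1.
Qed.

Let Ln_le a n x : p a <= 1 -> p (iter n (L a) x) <= p x.
Proof.
by move=> a1; elim: n => //= n IHn; apply: le_trans (L_le _ a1) IHn.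
Qed.

Let Ln_anti a m n x : p a <= 1 -> (m <= n)%N ->
  p (iter n (L a) x) <= p (iter m (L a) x).
Proof. by move=> a1 mn; rewrite -(subnK mn) iterD Ln_le. Qed.

Let Ln_tp a n b c d :
  tp (iter n (L a) b) (iter n (L a) c) (iter n (L a) d) =
  iter (3 * n) (L a) (tp b c d).
Proof.
elim: n b c d => [//|n IHn] b c d.
rewrite mulnS iterD -IHn /= -(tp_opl hE hcomm) -(tp_opm hE hcomm).
by rewrite -(tp_opr hcomm a a).
Qed.

Let Ln_cube a n x : p (iter n (L a) x) ^+ 3 <= p (iter (3 * n) (L a) (tp x x x)).
Proof. by rewrite -Ln_tp (ts_cube hts). Qed.

Let Ln_seminorm a n : seminorm (fun x => p (iter n (L a) x)).
Proof.
split=> [x z|l x].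
  have -> : iter n (L a) (x + z) = iter n (L a) x + iter n (L a) z.
    by elim: n => //= n ->; rewrite /L (tpDr hE).
  exact: (seminormD hp).
have -> : iter n (L a) (l *: x) = l *: iter n (L a) x.
  by elim: n => //= n ->; rewrite /L (tpZr hE).
exact: (seminormZ hp).
Qed.

(** The infimum over [n] of [p (L(a,a)^n x)] keeps of [p] only the part where
    [|a|] is equal to 1. It is again a triple seminorm as soon as it is at least
    1 at [y], and by minimality it is then [p] itself. *)
Lemma localization_invariant a : p a <= 1 ->
  (forall n, 1 <= p (iter n (L a) y)) -> forall x, p (tp a a x) = p x.
Proof.
move=> a1 hy x; pose F := [set (fun x => p (iter n (L a) x)) | n in [set: nat]].
have Fsemi q : F q -> seminorm q by move=> [n _ <-]; exact: Ln_seminorm.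
have F0 : F !=set0 by exists (fun x => p (iter 0 (L a) x)), 0%N.
have ts : triple_seminorm (inf_seminorm F).
  apply: inf_triple_seminorm => //.
  - by move=> _ [n _ <-] z; apply: le_trans (Ln_le _ _ a1) (ts_le_norm hts z).
  - by move=> _ [n _ <-].
  - move=> _ _ [m _ <-] [n _ <-]; exists (fun x => p (iter (maxn m n) (L a) x)).
    split=> [|z|z]; first by exists (maxn m n).
      by rewrite Ln_anti ?leq_maxl.
    by rewrite Ln_anti ?leq_maxr.
  - move=> _ [n _ <-]; exists (fun x => p (iter (3 * n) (L a) x)).
      by exists (3 * n)%N.
    by move=> b c d; rewrite -Ln_tp (ts_tp_le hts).
  - move=> _ [n _ <-]; exists (fun x => p (iter n (L a) x)); first by exists n.
    move=> z; apply: le_trans (Ln_cube _ _ _) _.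
    by rewrite Ln_anti // leq_pmull.
have le n z : inf_seminorm F z <= p (iter n (L a) z).
  by apply: (inf_seminorm_le F0 Fsemi (q := fun x => p (iter n (L a) x))); exists n.
have e := hmin.2 _ ts (le 0%N).
apply/eqP; rewrite eq_le L_le //=; have := le 1%N x; rewrite e; exact.
Qed.

(** The cube of [L(y,y)^n y] is [L(y,y)^(3n+1) y], so that the lower bound 1
    passes from [n] to [3n+1], hence to [n+1]. *)
Lemma Ly_isometry x : p (tp y y x) = p x.
Proof.
have y_le1 : p y <= 1 by rewrite minimal_at_y.
apply: localization_invariant => //; elim=> [|n IHn]; first exact: ts_ge1 hts.
have : 1 <= p (iter n (L y) y) ^+ 3 by rewrite exprn_ege1.
move=> /le_trans; apply; apply: le_trans (Ln_cube _ _ _) _.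
by rewrite -iterSr Ln_anti // ltnS leq_pmull.
Qed.

Let L_comm a b n x : L b (iter n (L a) x) = iter n (L a) (L b x).
Proof. by elim: n => //= n <-; rewrite /L (tp_opr hcomm). Qed.

(** As [L(y,y)] is isometric for [p], [{a,a,a}] has the same seminorm as
    [{y,y,{a,a,a}} = {y,{a,a,y},a}], which shows that [p {a,a,y}] is at least 1;
    cubing then propagates the bound to all [L(a,a)^n y]. *)
Lemma L_isometry a x : p a = 1 -> p (tp a a x) = p x.
Proof.
move=> a1; have a_le1 : p a <= 1 by rewrite a1.
apply: localization_invariant => // -[|n]; first exact: ts_ge1 hts.
elim: n => [|n IHn].
  have := ts_cube hts a; rewrite a1 expr1n => /le_trans; apply.
  rewrite -Ly_isometry (tp_opr hcomm) (tp_opm hE hcomm).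
  apply: le_trans (ts_tp_le hts _ _ _) _.
  by rewrite minimal_at_y a1 mul1r mulr1.
have : 1 <= p (iter n.+1 (L a) y) ^+ 3 by rewrite exprn_ege1.
move=> /le_trans; apply; apply: le_trans (Ln_cube _ _ _) _.
rewrite -/(L y y) -L_comm /L Ly_isometry Ln_anti //; lia.
Qed.

Lemma L_mult a x : p (tp a a x) = p a ^+ 2 * p x.
Proof.
have [a0|a0] := eqVneq (p a) 0.
  apply/eqP; rewrite a0 expr0n mul0r eq_le p_ge0 andbT.
  by apply: le_trans (ts_tp_le hts _ _ _) _; rewrite a0 !mul0r.
have a_gt0 : 0 < p a by rewrite lt_neqAle eq_sym a0 p_ge0.
pose l : R[i] := ((p a)^-1)%:C.
have cl : cmod l = (p a)^-1 by rewrite cmod_real // invr_ge0.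
have := @L_isometry (l *: a) x.
rewrite (seminormZ hp) cl mulVf // => /(_ erefl).
rewrite (tpZl hE) (tpZm hE) !(seminormZ hp) cmodJ cl => <-.
by field.
Qed.

(** [L(a,b) L(b,a) = L(a,a) L(b,b)] multiplies [p] by [(p a * p b)^2], and each
    of the factors [L(a,b)], [L(b,a)] by at most [p a * p b]. *)
Lemma minimal_multiplicative a b c : p (tp a b c) = p a * p b * p c.
Proof.
apply/eqP; rewrite eq_le (ts_tp_le hts) /=.
have [ab0|ab0] := eqVneq (p a * p b) 0; first by rewrite ab0 mul0r.
have ab_gt0 : 0 < p a * p b by rewrite lt_neqAle eq_sym ab0 mulr_ge0.
have := ts_tp_le hts b a (tp a b c).
rewrite -(tp_swap hE hcomm) !L_mult => h.
rewrite -(ler_pM2l ab_gt0) [leRHS](_ : _ = p b * p a * p (tp a b c)).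
  by rewrite [leLHS](_ : _ = p b ^+ 2 * (p a ^+ 2 * p c)) //; ring.
by rewrite (mulrC (p b)).
Qed.

End Minimal.
End Localization.

(** * Characters *)

Section Characters.
Context {R : realType} {E : completeNormedModType R[i]}.
Variable tp : E -> E -> E -> E.
Implicit Types (chi : E -> R[i]).

(** A point evaluation, up to the sign [e] of the triple product at the point. *)
Record triple_character chi : Prop := {
  char_linear : forall (l : R[i]) x z, chi (l *: x + z) = l * chi x + chi z;
  char_le_norm : forall x, cmod (chi x) <= rnorm x;
  char_tp : exists2 e, e ^+ 2 = 1 &
    forall a b c, chi (tp a b c) = e * (chi a * conjc (chi b) * chi c)
}.

Section CharacterTheory.
Variable chi : E -> R[i].
Hypothesis hchi : triple_character chi.

Lemma charD x z : chi (x + z) = chi x + chi z.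
Proof. by have := char_linear hchi 1 x z; rewrite scale1r mul1r. Qed.

Lemma char0 : chi 0 = 0.
Proof. by apply: addself_eq0; rewrite -charD addr0. Qed.

Lemma charZ l x : chi (l *: x) = l * chi x.
Proof. by have := char_linear hchi l x 0; rewrite char0 !addr0. Qed.

Lemma charB x z : chi (x - z) = chi x - chi z.
Proof. by rewrite charD -scaleN1r charZ mulN1r. Qed.

(** Applying [L(z,z)] twice removes the sign [e]. *)
Lemma char_tp_sqr z x : chi (tp z z (tp z z x)) = (cmod (chi z) ^+ 4)%:C * chi x.
Proof.
have [e e2 he] := char_tp hchi; rewrite !he mulcJ.
set A := _%:C; have -> : (cmod (chi z) ^+ 4)%:C = A * A.
  by rewrite /A -rmorphM /= -exprD.
have -> : e * (A * (e * (A * chi x))) = e ^+ 2 * (A * A * chi x) by ring.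
by rewrite e2 mul1r.
Qed.

End CharacterTheory.

Hypothesis hE : is_JBstar_triple tp.
Hypothesis hcomm : commutative_triple tp.

(** For a minimal seminorm [p], the product [(a, b) |-> {a,y,b}] is multiplicative
    for [p], so that modulo the kernel of [p] every [a] is a multiple
    [chi a *: y] of [y]. *)
Lemma exists_character (y : E) : rnorm y = 1 ->
  exists2 chi, triple_character chi & chi y = 1.
Proof.
move=> y1; have [p hmin] := exists_minimal_seminorm hE hcomm y1.
have hts := hmin.1; have hp := ts_seminorm hts.
have py := minimal_at_y hmin y1.
have pM := minimal_multiplicative hE hcomm hmin y1.
have GM a : exists l : R[i], p (a - l *: y) = 0.
  apply: (@gelfand_mazur _ _ p (fun a b => tp a y b)) => //.
  - by move=> b c; exact: (tpC hE).
  - by move=> c; exact: (triple_linear hE).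
  - by move=> b c; rewrite pM py mulr1.
have [chi hchi] := choice GM.
have chi_eq a l : p (a - l *: y) = 0 -> chi a = l.
  move=> h; apply/eqP; rewrite -subr_eq0 -cmod_eq0 eq_le cmod_ge0 andbT.
  rewrite -[cmod _]mulr1 -py -(seminormZ hp) scalerBl.
  rewrite (_ : _ - _ = (a - l *: y) - (a - chi a *: y)).
    by apply: le_trans (seminormB hp _ _) _; rewrite h hchi addr0.
  by rewrite opprB [RHS]addrC addrA subrK.
have chi_p a : cmod (chi a) = p a.
  by rewrite (seminorm_congr hp (hchi a)) (seminormZ hp) py mulr1.
have chi_y : chi y = 1 by apply: chi_eq; rewrite scale1r subrr (seminorm0 hp).
have chi_lin (l : R[i]) x z : chi (l *: x + z) = l * chi x + chi z.
  apply: chi_eq; rewrite scalerDl opprD addrACA -scalerA -scalerBr.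
  apply/eqP; rewrite eq_le (seminorm_ge0 hp) andbT.
  apply: le_trans (seminormD hp _ _) _.
  by rewrite (seminormZ hp) !hchi mulr0 addr0.
have chi_congr a b : p (a - b) = 0 -> chi a = chi b.
  move=> h; apply: chi_eq; rewrite -(hchi b); apply: seminorm_congr => //.
  by rewrite opprB addrA subrK.
have chi_scale l a : chi (l *: a) = l * chi a.
  apply: chi_eq; rewrite -scalerA -scalerBr (seminormZ hp) hchi mulr0 //.
have sub_tpl a b x z : tp a x z - tp b x z = tp (a - b) x z.
  by rewrite -[b in RHS]scale1r -scaleNr (tpDl hE) (tpZl hE) scaleN1r.
have sub_tpm a b x z : tp x a z - tp x b z = tp x (a - b) z.
  rewrite -[b in RHS]scale1r -scaleNr (tpDm hE) (tpZm hE).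
  rewrite (_ : conjc _ = -1) ?scaleN1r //.
  by rewrite rmorphN; congr (- _); exact: conjc1.
have chi_l a x z : chi (tp a x z) = chi a * chi (tp y x z).
  rewrite -chi_scale -(tpZl hE); apply: chi_congr.
  by rewrite sub_tpl pM hchi !mul0r.
have chi_r a x z : chi (tp x z a) = chi a * chi (tp x z y).
  by rewrite (tpC hE) chi_l (tpC hE).
have chi_m a x z : chi (tp x a z) = conjc (chi a) * chi (tp x y z).
  rewrite -chi_scale -(tpZm hE); apply: chi_congr.
  by rewrite sub_tpm pM hchi mulr0 mul0r.
exists chi => //; split=> //.
  by move=> x; rewrite chi_p (ts_le_norm hts).
exists (chi (tp y y y)); last by move=> a b c; rewrite chi_l chi_m chi_r; ring.
(* [{y,y,{y,y,y}} = {y,{y,y,y},y}] gives [e * e = e^* * e = |e|^2 = 1]. *)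
have := chi_r (tp y y y) y y; rewrite (tp_opm hE hcomm) chi_m => h.
by rewrite expr2 -h mulrC mulcJ chi_p pM !py !mulr1 expr1n.
Qed.

Lemma character_norming (x : E) :
  exists2 chi, triple_character chi & cmod (chi x) = rnorm x.
Proof.
have [->|x0] := eqVneq x 0.
  exists (fun=> 0); last by rewrite cmod0 rnorm0.
  split=> [l u v|u|]; first by rewrite mulr0 addr0.
    by rewrite cmod0 rnorm_ge0.
  by exists 1 => [|a b c]; rewrite ?expr1n // mul0r mul1r mul0r.
have nx := rnorm_gt0 x0.
pose l : R[i] := ((rnorm x)^-1)%:C.
have cl : cmod l = (rnorm x)^-1 by rewrite cmod_real // invr_ge0 ltW.
have [|chi hchi] := @exists_character (l *: x).
  by rewrite rnormZ cl mulVf // gt_eqF.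
rewrite (charZ hchi) => /(congr1 cmod); rewrite cmodM cl cmod1 => h.
exists chi => //; apply: (mulfI (x := (rnorm x)^-1)).
  by rewrite invr_eq0 gt_eqF.
by rewrite h mulVf // gt_eqF.
Qed.

End Characters.

(** * Peaking at a character *)

Section PeakDecomposition.
Context {R : realType} {E : completeNormedModType R[i]}.
Variable tp : E -> E -> E -> E.
Hypothesis hE : is_JBstar_triple tp.
Hypothesis hcomm : commutative_triple tp.

(** At a character this is multiplication by [1 - |z|^4 / 16], which lies in
    [0, 1] when the norm of [z] is at most 2. *)
Definition damp (z u : E) : E := u - (16^-1 : R)%:C *: tp z z (tp z z u).

Lemma char_damp chi z u n : triple_character tp chi ->
  chi (iter n (damp z) u) = ((1 - cmod (chi z) ^+ 4 / 16) ^+ n)%:C * chi u.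
Proof.
move=> hchi; elim: n => [|n IHn]; first by rewrite mul1r.
rewrite /= (charB hchi) (charZ hchi) (char_tp_sqr hchi) IHn.
set s : R := cmod (chi z) ^+ 4; set q := (1 - s / 16) ^+ n.
have -> : ((1 - s / 16) ^+ n.+1)%:C = (1 - s%:C * (16^-1)%:C) * q%:C.
  by rewrite exprS !(rmorphM, rmorphB, rmorph1).
ring.
Qed.

(** Write [chi x0] as a convex combination of two opposite unimodular numbers
    [u] and [- u], and let [F] be a high power of [damp z] for
    [z = x0 - chi x0 *: y]. Then [x0 + F (w *: y - x0)], for [w = u] and
    [w = - u], is at each character a convex combination of the values of [x0]
    and [w *: y], hence has norm at most 1; at [chi], where [z] vanishes, it
    takes the value [w]. Recombining the two elements gives [x0 - F z], and [F z]
    is small: a character is small on it because either it is small on [z], or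
    its damping factor is bounded away from 1. *)
Lemma peak_decomposition chi (x0 y : E) (e : R) :
    triple_character tp chi -> chi y = 1 -> rnorm y <= 1 -> rnorm x0 <= 1 ->
    0 < e <= 1 ->
  exists x1 x2 (l : R), [/\ rnorm x1 <= 1 /\ cmod (chi x1) = 1,
    rnorm x2 <= 1 /\ cmod (chi x2) = 1, 0 <= l <= 1 &
    rnorm (x0 - (l%:C *: x1 + (1 - l)%:C *: x2)) <= e].
Proof.
move=> hchi chiy y1 x1 /andP[e0 e1].
have [u u1 chi0] := unimodular_polar (chi x0).
set r := cmod (chi x0) in chi0.
have r0 : 0 <= r by apply: cmod_ge0.
have r1 : r <= 1 by apply: le_trans (char_le_norm hchi _) x1.
pose z := x0 - chi x0 *: y.
have z2 : rnorm z <= 2.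
  have rnS := rnorm_seminorm E.
  apply: le_trans (seminormB rnS _ _) _; rewrite rnormZ -/r.
  have : r * rnorm y <= 1 by rewrite mulr_ile1 ?rnorm_ge0.
  lra.
have e4 : e ^+ 4 <= 1 by rewrite exprn_ile1 // ltW.
have e40 : 0 < e ^+ 4 by rewrite exprn_gt0.
have q01 : 0 <= 1 - e ^+ 4 / 16 < 1 by apply/andP; split; lra.
have e20 : 0 < e / 2 by lra.
have [n hn] := expr_small q01 e20.
pose x w := x0 + iter n (damp z) (w *: y - x0).
have factor chi' : triple_character tp chi' ->
    exists q : R, [/\ 0 <= q <= 1, q * cmod (chi' z) <= e &
      forall v, chi' (iter n (damp z) v) = q%:C * chi' v].
  move=> hchi'; set t := cmod (chi' z).
  have t0 : 0 <= t by apply: cmod_ge0.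
  have t2 : t <= 2 by apply: le_trans (char_le_norm hchi' _) z2.
  have t4 : 0 <= t ^+ 4 <= 16.
    rewrite exprn_ge0 //= (_ : 16 = 2 ^+ 4 :> R) ?lerXn2r ?nnegrE //.
    by rewrite -natrX.
  have q1 : 0 <= 1 - t ^+ 4 / 16 <= 1.
    by move/andP: t4 => [? ?]; apply/andP; split; lra.
  have qn1 : 0 <= (1 - t ^+ 4 / 16) ^+ n <= 1.
    by move/andP: q1 => [? ?]; rewrite exprn_ge0 //= exprn_ile1.
  exists ((1 - t ^+ 4 / 16) ^+ n); split=> // [|v]; last exact: char_damp.
  move/andP: qn1 => [qn0 qn1].
  have [te|et] := leP t e.
    by apply: le_trans te; rewrite ler_piMl.
  have : (1 - t ^+ 4 / 16) ^+ n <= (1 - e ^+ 4 / 16) ^+ n.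
    move/andP: q1 => [qa qb]; move/andP: q01 => [qc _].
    rewrite lerXn2r ?nnegrE // lerD2l lerN2 ler_pM2r ?invr_gt0 //.
    by rewrite lerXn2r ?nnegrE // ltW.
  nra.
have x_le w : cmod w = 1 -> rnorm (x w) <= 1.
  move=> w1; have [chi' hchi' <-] := character_norming hE hcomm (x w).
  have [q [/andP[q0 q1] _ hq]] := factor chi' hchi'.
  rewrite (charD hchi') hq (charB hchi') (charZ hchi').
  rewrite (_ : _ + _ = (1 - q)%:C * chi' x0 + q%:C * w * chi' y); last first.
    by rewrite rmorphB rmorph1; ring.
  apply: le_trans (cmodD _ _) _; rewrite !cmodM w1 !cmod_real ?subr_ge0 //.
  have := le_trans (char_le_norm hchi' x0) x1.
  have := le_trans (char_le_norm hchi' y) y1.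
  by nra.
have chi_x w : chi (x w) = w.
  have [q [_ _ hq]] := factor chi hchi.
  have chiz : chi z = 0 by rewrite (charB hchi) (charZ hchi) chiy mulr1 subrr.
  rewrite (charD hchi) (char_damp _ _ _ hchi) chiz cmod0.
  rewrite expr0n mul0r subr0 expr1n mul1r (charB hchi) (charZ hchi) chiy mulr1.
  by rewrite addrC subrK.
exists (x u), (x (- u)), ((1 + r) / 2).
rewrite !x_le ?cmodN // !chi_x ?cmodN; split=> //.
  by apply/andP; split; lra.
set v := (X in rnorm X); have [chi' hchi' <-] := character_norming hE hcomm v.
rewrite {}/v.
have [q [/andP[q0 q1] qe hq]] := factor chi' hchi'.
have qz : q * cmod (chi' z) = cmod (q%:C * chi' z) by rewrite cmodM cmod_real.
apply: le_trans qe; rewrite qz.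
rewrite [chi' z](charB hchi') /x (charB hchi') (charD hchi') !(charZ hchi').
rewrite !(charD hchi' x0) !hq !(charB hchi') !(charZ hchi') chi0.
rewrite le_eqVlt; apply/orP; left; apply/eqP; congr cmod.
have -> : (1 - (1 + r) / 2) = (1 - r) / 2 by lra.
have -> : ((1 + r) / 2)%:C = (1 + r%:C) / 2.
  by rewrite rmorphM rmorphD rmorph1 fmorphV /= rmorph_nat.
have -> : ((1 - r) / 2)%:C = (1 - r%:C) / 2.
  by rewrite rmorphM rmorphB rmorph1 fmorphV /= rmorph_nat.
by field.
Qed.

End PeakDecomposition.

(** * Operator norms and numerical radii *)

Section OperatorNorm.
Context {R : realType} {X Y : normedModType R[i]}.
Variable T : X -> Y.
Hypothesis hT : bounded_op T.

Lemma bounded_opZ l x : T (l *: x) = l *: T x.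
Proof.
have [hl _] := hT; have T0 : T 0 = 0.
  by apply: addself_eq0; have := hl 1 0 0; rewrite !scale1r addr0.
by have := hl l x 0; rewrite T0 !addr0.
Qed.

Lemma bounded_opD x y : T (x + y) = T x + T y.
Proof. by have := hT.1 1 x y; rewrite !scale1r. Qed.

Lemma opnorm_has_sup : has_sup [set rnorm (T x) | x in [set x : X | `|x| <= 1]].
Proof.
have T0 : T 0 = 0 by rewrite -(scale0r 0) bounded_opZ scale0r.
split; first by exists (rnorm (T 0)), 0 => //=; rewrite normr0 ler01.
have := hT.2 0.
move=> /cvgr_dist_le /(_ 1 ltr01) /nbhs_ballP [d /= d0 hd].
have [r r0 rd] := exists_real_lt d0.
exists r^-1 => _ [x /= x1 <-].
have : rnorm (T (r%:C *: x)) <= 1.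
  rewrite -norm_le1; have := hd (r%:C *: x); rewrite /= T0 sub0r normrN; apply.
  rewrite -ball_normE /= sub0r normrN normrZ normc_cmod cmod_real ?(ltW r0) //.
  apply: le_lt_trans rd; rewrite -[leRHS]mulr1 ler_wpM2l // ler0c ltW //.
by rewrite bounded_opZ rnormZ cmod_real ?(ltW r0) // -[r^-1]mulr1 ler_pdivlMl.
Qed.

Lemma le_opnorm x : `|x| <= 1 -> rnorm (T x) <= opnorm T.
Proof. by move=> x1; apply: ub_le_sup; [case: opnorm_has_sup|exists x]. Qed.

Lemma rnorm_le_opnorm x : rnorm (T x) <= opnorm T * rnorm x.
Proof.
have [->|x0] := eqVneq x 0.
  by rewrite -(scale0r (0 : X)) bounded_opZ !scale0r !rnorm0 mulr0.
have nx := rnorm_gt0 x0.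
have ni : 0 <= (rnorm x)^-1 by rewrite invr_ge0 ltW.
have := @le_opnorm ((rnorm x)^-1%:C *: x).
rewrite norm_le1 bounded_opZ !rnormZ cmod_real // mulVf ?gt_eqF //.
move=> /(_ (lexx _)).
by rewrite mulrC ler_pdivrMr.
Qed.

End OperatorNorm.

Section NumericalRadius.
Context {R : realType} {X : normedModType R[i]}.
Implicit Types (T : X -> X) (phi : X -> R[i]^o).

Lemma num_radius_ge T x phi : bounded_op T -> opnorm T = 1 ->
    `|x| = 1 -> bounded_op phi -> opnorm phi = 1 -> phi x = 1 ->
  cmod (phi (T x)) <= num_radius T.
Proof.
move=> hT T1 x1 hphi phi1 phix; apply: ub_le_sup; last first.
  by exists (phi (T x)) => //; exists x, phi.
exists 1 => _ [_ [x' [phi' [/norm_eq1 x1' hphi' phi1' _ ->]]] <-].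
apply: le_trans (rnorm_le_opnorm hphi' (T x')) _; rewrite phi1' mul1r.
by apply: le_trans (rnorm_le_opnorm hT x') _; rewrite T1 x1' mulr1.
Qed.

Lemma contraction_bounded_op (Y : normedModType R[i]) (T : X -> Y) :
  linear T -> (forall z, rnorm (T z) <= rnorm z) -> bounded_op T.
Proof.
move=> hT le; split=> // x; apply/cvgrPdist_le => e e0; near=> t.
have -> : T x - T t = T (x - t).
  by rewrite addrC -scaleN1r -hT scaleN1r addrC.
rewrite norm_rnorm; apply: (@le_trans _ _ `|x - t|).
  by rewrite norm_rnorm lecR.
by near: t; apply: cvgr_dist_le.
Unshelve. all: by end_near. Qed.

Lemma bounded_op_id : bounded_op (@id X).
Proof. exact: contraction_bounded_op. Qed.

Lemma opnorm_eq1 (Y : normedModType R[i]) (T : X -> Y) x :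
    bounded_op T -> (forall z, rnorm (T z) <= rnorm z) ->
  `|x| = 1 -> rnorm (T x) = 1 -> opnorm T = 1.
Proof.
move=> hT le x1 Tx; apply/eqP; rewrite eq_le; apply/andP; split.
  apply: ge_sup; first by case: (opnorm_has_sup hT).
  by move=> _ [z /= z1 <-]; apply: le_trans (le z) _; rewrite -norm_le1.
by rewrite -{1}Tx le_opnorm // x1.
Qed.

End NumericalRadius.

(** * The numerical index *)

Section NumericalIndex.
Context {R : realType} {E : completeNormedModType R[i]}.
Variable tp : E -> E -> E -> E.

Lemma rotated_character_le (chi : E -> R[i]) (c : R[i]) z :
  triple_character tp chi -> cmod c = 1 ->
  rnorm (c * chi z : R[i]^o) <= rnorm z.
Proof.
move=> hchi c1; rewrite [leLHS](_ : _ = cmod (c * chi z)) //.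
by rewrite cmodM c1 mul1r (char_le_norm hchi).
Qed.

Lemma character_bounded_op (chi : E -> R[i]) (c : R[i]) :
  triple_character tp chi -> cmod c = 1 ->
  bounded_op (fun x => c * chi x : R[i]^o).
Proof.
move=> hchi c1; apply: contraction_bounded_op => [l x z|z].
  by rewrite (char_linear hchi) mulrDr mulrCA.
exact: rotated_character_le.
Qed.

Lemma character_opnorm (chi : E -> R[i]) (c : R[i]) x :
    triple_character tp chi -> cmod c = 1 -> `|x| = 1 -> cmod (chi x) = 1 ->
  opnorm (fun x => c * chi x : R[i]^o) = 1.
Proof.
move=> hchi c1 x1 chix; apply: (@opnorm_eq1 _ _ _ _ x) => //.
- exact: character_bounded_op.
- by move=> z; exact: rotated_character_le.
- by rewrite [LHS](_ : _ = cmod (c * chi x)) // cmodM c1 chix mulr1.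
Qed.

Hypothesis hE : is_JBstar_triple tp.
Hypothesis hcomm : commutative_triple tp.

(** If [T x0] has norm at least [1 - e] and [chi] attains that norm, then one of
    the two elements into which [x0] decomposes, up to [e], has an image on which
    [chi] is at least [1 - 2 e] in modulus. Rotated to take the value 1 at that
    element, [chi] becomes a state there. *)
Lemma num_radius_approx (T : E -> E) (e : R) :
  bounded_op T -> opnorm T = 1 -> 0 < e < 1 -> 1 - 2 * e <= num_radius T.
Proof.
move=> hT T1 /andP[e0 e1].
have [_ [x0 /= x01 <-]] := sup_adherent e0 (opnorm_has_sup hT).
rewrite -/(opnorm T) T1 => hx0; set N := rnorm (T x0) in hx0.
have N0 : 0 < N by lra.
have iN : cmod (N^-1)%:C = N^-1 by rewrite cmod_real // invr_ge0 ltW.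
have y1 : rnorm ((N^-1)%:C *: T x0) = 1 by rewrite rnormZ iN mulVf // gt_eqF.
have [chi hchi chiy] := exists_character hE hcomm y1.
have chiT : chi (T x0) = N%:C.
  move: chiy; rewrite (charZ hchi) => h.
  rewrite -[LHS]mul1r -(_ : N%:C * (N^-1)%:C = 1) -?mulrA ?h ?mulr1 //.
  by rewrite -rmorphM divff ?rmorph1 // gt_eqF.
have [x1 [x2 [l [[x11 chi1] [x21 chi2] /andP[l0 l1] happ]]]] :
  exists x1 x2 (l : R), [/\ rnorm x1 <= 1 /\ cmod (chi x1) = 1,
    rnorm x2 <= 1 /\ cmod (chi x2) = 1, 0 <= l <= 1 &
    rnorm (x0 - (l%:C *: x1 + (1 - l)%:C *: x2)) <= e].
  apply: (peak_decomposition hE hcomm hchi chiy); rewrite ?y1 //.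
    by rewrite -norm_le1.
  by rewrite e0 ltW.
have attain x : rnorm x <= 1 -> cmod (chi x) = 1 -> cmod (chi (T x)) <= num_radius T.
  move=> xle chix; have x1' : `|x| = 1.
    by apply/norm_eq1/eqP; rewrite eq_le xle -chix (char_le_norm hchi).
  pose c := conjc (chi x); have c1 : cmod c = 1 by rewrite cmodJ.
  have := @num_radius_ge _ _ T x (fun x => c * chi x) hT T1 x1'.
  rewrite cmodM c1 mul1r; apply; first exact: character_bounded_op.
    exact: (character_opnorm hchi c1 x1' chix).
  by rewrite mulrC mulcJ chix expr1n.
have h1 := attain _ x11 chi1; have h2 := attain _ x21 chi2.
have : N <= l * cmod (chi (T x1)) + (1 - l) * cmod (chi (T x2)) + e.
  set v := x0 - _ in happ.
  have ex : x0 = l%:C *: x1 + (1 - l)%:C *: x2 + v by rewrite addrC subrK.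
  clearbody v.
  rewrite -[leLHS]cmod_real ?(ltW N0) // -chiT ex.
  rewrite !(bounded_opD hT) !(bounded_opZ hT).
  rewrite !(charD hchi) !(charZ hchi).
  apply: le_trans (cmodD _ _) _; apply: lerD.
    by apply: le_trans (cmodD _ _) _; rewrite !cmodM !cmod_real // subr_ge0.
  apply: le_trans (char_le_norm hchi _) _; apply: le_trans (rnorm_le_opnorm hT _) _.
  by rewrite T1 mul1r.
nra.
Qed.

End NumericalIndex.

Theorem lemma3p1 (R : realType) (E : completeNormedModType R[i])
    (tp : E -> E -> E -> E) (hE : is_JBstar_triple tp)
    (hcomm : commutative_triple tp) (hE0 : exists x : E, x != 0%R) :
  num_index E = 1%R.
Proof.
have ge1 (T : E -> E) : bounded_op T -> opnorm T = 1 -> 1 <= num_radius T.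
  move=> hT T1; apply/ler_addgt0Pr => e e0.
  have [d [d0 d1 de]] : exists d : R, [/\ 0 < d, d < 1 & 2 * d <= e].
    exists (Num.min e 1 / 2); have [?|?] := leP e 1; split; lra.
  have d01 : 0 < d < 1 by rewrite d0.
  have := num_radius_approx hE hcomm hT T1 d01; lra.
have [x0 nx0] := hE0.
have nx := rnorm_gt0 nx0.
have id1 : opnorm (@id E) = 1.
  apply: (@opnorm_eq1 _ _ _ _ ((rnorm x0)^-1%:C *: x0)) => //.
  - exact: bounded_op_id.
  - apply/norm_eq1.
    by rewrite rnormZ cmod_real ?invr_ge0 ?(ltW nx) // mulVf // gt_eqF.
  - by rewrite rnormZ cmod_real ?invr_ge0 ?(ltW nx) // mulVf // gt_eqF.
have id_le : num_radius (@id E) <= 1.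
  have rid := ge1 _ (@bounded_op_id R E) id1.
  have [ne|ne] := pselect ([set complex.Re `|l| | l in num_range (@id E)] !=set0).
    apply: ge_sup => // _ [_ [x [phi [_ _ _ phix ->]]] <-].
    by rewrite phix normr1.
  by move: rid; rewrite /num_radius sup_out ?ler10 //; case.
apply/eqP; rewrite eq_le; apply/andP; split.
  apply: le_trans id_le; apply: ge_inf.
    by exists 1 => _ [T [hT T1] <-]; exact: ge1.
  by exists id => //; split=> //; exact: bounded_op_id.
apply: lb_le_inf; last by move=> _ [T [hT T1] <-]; exact: ge1.
exists (num_radius (@id E)), id => //; split=> //; exact: bounded_op_id.
Qed.
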